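(* Let $\boldsymbol{X}_1,\ldots,\boldsymbol{X}_n$ be a random sample from a $d$-dimensional distribution with continuous margins, and let $\tilde{\boldsymbol{\kappa}}_n = (\kappa_{I,n} : I \in \mathcal{P}(\mathcal{D}))$ be the empirical concordance signature. Assuming that $n\ge 2$ and there are no ties in the sample, there exists a unique $d$-dimensional extremal mixture copula $C_n$ such that $\tilde{\boldsymbol{\kappa}}_n = \tilde{\boldsymbol{\kappa}}(C_n)$.
   Context: Let $d\ge2$, $\mathcal{D}=\{1,\ldots,d\}$, and let $\mathcal{P}(\mathcal{D})$ be the power set of $\mathcal{D}$. Write $\boldsymbol{X}_i=(X_{i1},\ldots,X_{id})$. ''No ties'' means that for each $k\in\mathcal{D}$ the values $X_{1k},\ldots,X_{nk}$ are pairwise distinct. Empirical concordance probabilities: for $|I|\ge 2$, $$\kappa_{I,n} = \frac{2}{n(n-1)}\sum_{i\ne j}\prod_{k\in I}\mathbf{1}_{\{X_{ik}\le X_{jk}\}},$$ where the sum is over ordered pairs of distinct $i,j\in\{1,\ldots,n\}$; and $\kappa_{I,n}=1$ when $|I|\le 1$. Concordance probabilities of a copula $C$ (distribution function on $[0,1]^d$ with standard uniform margins): let $\boldsymbol{U}\sim C$ and $\boldsymbol{U}^*$ an independent copy. For $I\subseteq\mathcal{D}$, $\boldsymbol{U}_I$ is the subvector with indices in $I$ and $C_I$ its distribution function. For $|I|\ge 2$, $\kappa(C_I) = \mathbb{P}(\{\boldsymbol{U}_I \le \boldsymbol{U}_I^*\}\cup\{\boldsymbol{U}_I^*\le \boldsymbol{U}_I\})$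 (componentwise inequalities); $\kappa(C_I) = 1$ when $|I|\le 1$. The full concordance signature of $C$ is $\tilde{\boldsymbol{\kappa}}(C) = (\kappa(C_I): I\in\mathcal{P}(\mathcal{D}))$. Extremal copulas: for $k\in\{1,\ldots,2^{d-1}\}$ let $\boldsymbol{s}_k\in\{0,1\}^d$ be the vector of digits of $k-1$ written as a $d$-digit binary number, let $J_k=\{j\in\mathcal{D}: s_{k,j}=0\}$ and $J_k^\complement = \mathcal{D}\setminus J_k$. The $k$th extremal copula is $C^{(k)}(\boldsymbol{u}) = (\min_{j\in J_k}u_j + \min_{j\in J_k^\complement}u_j - 1)^+$, with $\min_{j\in\emptyset}u_j = 1$ and $x^+=\max(x,0)$. An extremal mixture copula is a copula of the form $\sum_{k=1}^{2^{d-1}} w_k C^{(k)}$ with $w_k\ge 0$ and $\sum_k w_k = 1$. *)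

(* Defs.v *)
From HB Require Import structures.
From mathcomp Require Import all_boot all_order all_algebra.
From mathcomp Require Import all_classical all_reals all_analysis.

Set Implicit Arguments.
Unset Strict Implicit.
Unset Printing Implicit Defensive.

Import Order.TTheory GRing.Theory Num.Theory.
Import numFieldNormedType.Exports.

Local Open Scope classical_set_scope.
Local Open Scope ring_scope.

Section samples.
Context {dT : measure_display} {Omega : measurableType dT} {R : realType}.
Variables (P : probability Omega R) (d n : nat).

Definition obs (X : 'I_n -> 'I_d -> {RV P >-> R}) (i : 'I_n) (w : Omega) :
    d.-tuple R :=
  [tuple X i k w | k < d].

Definition identically_distributed (X : 'I_n -> 'I_d -> {RV P >-> R}) :=
  forall (i j : 'I_n) (A : set (d.-tuple R)), measurable A ->
    P (obs X i @^-1` A) = P (obs X j @^-1` A).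

(* The components of one observation [obs X i] may be dependent: the product
   rule is only required across observations. *)
Definition mutually_independent (X : 'I_n -> 'I_d -> {RV P >-> R}) :=
  forall (J : {set 'I_n}) (A : 'I_n -> set (d.-tuple R)),
    (forall i, measurable (A i)) ->
    P (\bigcap_(i in [set` J]) (obs X i @^-1` A i)) =
      (\prod_(i in J) P (obs X i @^-1` A i))%E.

Definition random_sample (X : 'I_n -> 'I_d -> {RV P >-> R}) :=
  identically_distributed X /\ mutually_independent X.

Definition continuous_margins (X : 'I_n -> 'I_d -> {RV P >-> R}) :=
  forall (i : 'I_n) (k : 'I_d), continuous (cdf (X i k)).

End samples.

Section empirical.
Context {R : realType} {d n : nat}.

Definition no_ties (x : 'I_n -> 'I_d -> R) :=
  forall k : 'I_d, injective (fun i => x i k).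

Definition emp_kappa (x : 'I_n -> 'I_d -> R) (I : {set 'I_d}) : R :=
  if (#|I| <= 1)%N then 1
  else 2 / (n%:R * (n%:R - 1)) *
    \sum_(i < n) \sum_(j < n | i != j) \prod_(k in I) (x i k <= x j k)%R%:R.

Definition emp_signature (x : 'I_n -> 'I_d -> R) : {ffun {set 'I_d} -> R} :=
  [ffun I => emp_kappa x I].

End empirical.

Section copulas.
Context {R : realType} {d : nat}.

Definition orthant (a : 'I_d -> R) : set (d.-tuple R) :=
  [set x | forall j, tnth x j <= a j].

(* Q is the law on R^d of a random vector with standard uniform margins whose
   distribution function, restricted to the unit cube, is C. *)
Definition copula_law (C : d.-tuple {i01 R} -> R)
    (Q : probability (d.-tuple R) R) :=
  (forall (j : 'I_d) (A : set R), measurable A ->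
     Q ((fun x => tnth x j) @^-1` A) = uniform_prob (@ltr01 R) A) /\
  (forall u : d.-tuple {i01 R},
     Q (orthant (fun j => (tnth u j)%:num)) = (C u)%:E).

End copulas.

Lemma uniform_prob_null (R : realType) :
  uniform_prob (@ltr01 R) (~` `]0, 1]) = 0%E.
Proof.
rewrite /uniform_prob integral_uniform_pdf.
rewrite (_ : _ `&` _ = [set 0]); first by rewrite integral_set1.
apply/seteqP; split => x /=; rewrite !in_itv/=.
  move=> [/negP + /andP[x0 x1]]; rewrite x1 andbT -leNgt => x0'.
  by apply/eqP; rewrite eq_le x0 x0'.
by move=> ->; rewrite ltxx lexx ler01; split.
Qed.

Lemma measurable_tnth_preimage (R : realType) (d : nat) (j : 'I_d) (A : set R) :
  measurable A -> measurable ((fun x : d.-tuple R => tnth x j) @^-1` A).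
Proof.
by move=> mA; rewrite -[X in measurable X]setTI; exact: measurable_tnth.
Qed.

Lemma orthantE (R : realType) (d : nat) (a : 'I_d -> R) :
  orthant a = \bigcap_(j in [set: 'I_d])
    ((fun x : d.-tuple R => tnth x j) @^-1` `]-oo, a j]).
Proof.
apply/seteqP; split => x /= xa j.
  by move=> _ /=; rewrite in_itv/=; exact: xa.
by move: (xa j I) => /=; rewrite in_itv.
Qed.

Lemma measurable_orthant (R : realType) (d : nat) (a : 'I_d -> R) :
  measurable (orthant a).
Proof.
rewrite orthantE; apply: fin_bigcap_measurable => // j _.
exact: measurable_tnth_preimage.
Qed.

Lemma measurable_orthantE (R : realType) (d : nat) :
  @measurable _ (d.-tuple R) = <<s range (@orthant R d) >>.
Proof.
apply/seteqP; split; last first.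
  apply: smallest_sub; first exact: sigma_algebra_measurable.
  by move=> _ [a _ <-]; exact: measurable_orthant.
apply: smallest_sub; first exact: smallest_sigma_algebra.
pose G : set (set (d.-tuple R)) := range (@orthant R d).
pose T' := g_sigma_algebraType G.
move=> B; rewrite -bigcup_seq/= => -[j _ [A mA <-{B}]].
have mj : measurable_fun [set: T'] (fun x : T' => tnth (x : d.-tuple R) j).
  apply: (measurability _ (measurable_realfun.RGenOInfty.measurableE R)) => _ [_ [a ->] <-].
  rewrite setTI.
  rewrite (_ : _ @^-1` _ = ~` \bigcup_n orthant
      (fun i => if i == j then a else n%:R)).
    apply: measurableC; apply: bigcup_measurable => n _.
    by apply: sub_sigma_algebra; eexists.
  apply/seteqP; split => x /=; rewrite in_itv/= andbT.
    by move=> ax [n _ /(_ j)]; rewrite eqxx leNgt ax.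
  move=> nx; rewrite ltNge; apply/negP => xa; apply: nx.
  exists (\sum_i (Num.bound (tnth (x : d.-tuple R) i)))%N => // i.
  case: eqP => [->//|_].
  apply: (le_trans (ler_norm _)); apply: ltW.
  apply: (lt_le_trans (archi_boundP (normr_ge0 _))).
  rewrite ler_nat (bigD1 i)//=.
  have -> : Num.bound `|tnth (x : d.-tuple R) i| =
     Num.bound (tnth (x : d.-tuple R) i) by rewrite /Num.bound normr_id.
  exact: leq_addr.
have := mj measurableT A mA.
by rewrite setTI.
Qed.

Lemma copula_law_unique (R : realType) (d : nat) (C : d.-tuple {i01 R} -> R)
    (Q1 Q2 : probability (d.-tuple R) R) :
  copula_law C Q1 -> copula_law C Q2 ->
  forall A, measurable A -> Q1 A = Q2 A.
Proof.
pose clampR (r : R) := Num.max 0 (Num.min r 1).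
have c0 r : 0 <= clampR r by rewrite /clampR le_max lexx.
have c1 r : clampR r <= 1 by rewrite /clampR ge_max ler01 ge_min lexx orbT.
pose clamp (a : 'I_d -> R) : d.-tuple {i01 R} :=
  [tuple Itv01 (c0 (a j)) (c1 (a j)) | j < d].
pose N : set (d.-tuple R) :=
  \bigcup_(j in [set: 'I_d]) ((fun x => tnth x j) @^-1` (~` `]0, 1])).
have mN : measurable N.
  apply: fin_bigcup_measurable => // j _.
  by apply: measurable_tnth_preimage; exact: measurableC.
have N0 (Q : probability (d.-tuple R) R) : copula_law C Q -> Q N = 0%E.
  move=> [QU _]; apply/eqP; rewrite eq_le measure_ge0 andbT.
  apply: (le_trans (@content_sub_fsum _ _ _ Q _ [set: 'I_d] _
    (fun j => (fun x => tnth x j) @^-1` (~` `]0, 1])) _ _ mN _)) => //.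
  - exact: finite_finset.
  - by move=> j _; apply: measurable_tnth_preimage; exact: measurableC.
  rewrite fsbig1// => j _.
  have mj : measurable (~` `]0%R, 1%R] : set R) by exact: measurableC.
  by move: (QU j _ mj); rewrite uniform_prob_null.
have QC Q a : copula_law C Q -> Q (orthant a) = (C (clamp a))%:E.
  move=> QL; rewrite -(proj2 QL).
  rewrite -(measureU0 (measurable_orthant a) mN (N0 _ QL)).
  rewrite -[RHS](measureU0 (measurable_orthant _) mN (N0 _ QL)).
  congr (Q _); apply/seteqP; split => x [] xa; [|by right| |by right].
    have [xN|xN] := pselect (N x); [by right|left => j].
    have : tnth x j \in `]0, 1].
      by apply/negPn/negP => xj; apply: xN; exists j => //=; exact/negP.
    rewrite in_itv/= tnth_mktuple/= /clampR => /andP[x0 x1].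
    by rewrite le_max le_min (xa j) x1 orbT.
  have [xN|xN] := pselect (N x); [by right|left => j].
  have : tnth x j \in `]0, 1].
    by apply/negPn/negP => xj; apply: xN; exists j => //=; exact/negP.
  rewrite in_itv/= => /andP[x0 x1].
  move: (xa j); rewrite tnth_mktuple/= /clampR le_max leNgt x0/=.
  by rewrite le_min => /andP[].
move=> L1 L2.
apply: (measure_unique (range (@orthant R d)) (fun n => orthant (fun=> n%:R))).
- exact: measurable_orthantE.
- move=> _ _ [a _ <-] [b _ <-]; exists (fun j => Num.min (a j) (b j)) => //.
  apply/seteqP; split => x /=.
    by move=> xab; split => j; move: (xab j); rewrite le_min => /andP[].
  by move=> [xa xb] j; rewrite le_min xa xb.
- by move=> n; eexists.
- apply/seteqP; split => // x _.
  exists (\sum_i (Num.bound (tnth x i)))%N => // i.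
  apply: (le_trans (ler_norm _)); apply: ltW.
  apply: (lt_le_trans (archi_boundP (normr_ge0 _))).
  rewrite ler_nat (bigD1 i)//=.
  have -> : Num.bound `|tnth x i| = Num.bound (tnth x i).
    by rewrite /Num.bound normr_id.
  exact: leq_addr.
- by move=> _ [a _ <-]; exact: (etrans (QC _ a L1) (esym (QC _ a L2))).
- move=> n; apply: (@le_lt_trans _ _ 1%E); last exact: ltry.
  by apply: probability_le1; exact: measurable_orthant.
Qed.

Record copula (R : realType) (d : nat) := Copula {
  copula_df :> d.-tuple {i01 R} -> R ;
  copula_dfP : exists Q : probability (d.-tuple R) R, copula_law copula_df Q }.

(* The chosen law is the only one, on measurable sets: see [copula_law_unique]. *)
Definition law (R : realType) (d : nat) (C : copula R d) :
    probability (d.-tuple R) R :=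
  projT1 (cid (copula_dfP C)).

Lemma law_copula (R : realType) (d : nat) (C : copula R d) :
  copula_law C (law C).
Proof. exact: (projT2 (cid (copula_dfP C))). Qed.

Section concordance.
Context {R : realType} {d : nat}.

Definition concordant (I : {set 'I_d}) (x y : d.-tuple R) :=
  (forall k, k \in I -> tnth x k <= tnth y k) \/
  (forall k, k \in I -> tnth y k <= tnth x k).

(* The product measure is the joint law of a vector distributed as C and an
   independent copy of it; [kappaE] gives the formula for any such pair. *)
Definition kappa (C : copula R d) (I : {set 'I_d}) : R :=
  if (#|I| <= 1)%N then 1
  else fine ((law C \x law C)%E [set z | concordant I z.1 z.2]).

Definition signature (C : copula R d) : {ffun {set 'I_d} -> R} :=
  [ffun I => kappa C I].

End concordance.

Lemma measurable_concordant (R : realType) (d : nat) (I : {set 'I_d}) :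
  measurable [set z : d.-tuple R * d.-tuple R | concordant I z.1 z.2].
Proof.
have m1 k : measurable_fun [set: d.-tuple R * d.-tuple R]
    (fun z => tnth z.1 k).
  exact: (measurableT_comp (measurable_tnth k) measurable_fst).
have m2 k : measurable_fun [set: d.-tuple R * d.-tuple R]
    (fun z => tnth z.2 k).
  exact: (measurableT_comp (measurable_tnth k) measurable_snd).
rewrite (_ : [set _ | _] =
    (\bigcap_(k in [set` I]) [set z | tnth z.1 k <= tnth z.2 k]) `|`
    (\bigcap_(k in [set` I]) [set z | tnth z.2 k <= tnth z.1 k])).
  by apply: measurableU; apply: fin_bigcap_measurable => // k _;
    rewrite -[X in measurable X]setTI; exact: measurable_fun_le.
by apply/seteqP; split => z [h|h]; [left|right|left|right] => k kI; exact: h.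
Qed.

Lemma kappaE (R : realType) (d : nat) (C : copula R d) (I : {set 'I_d})
    (dT : measure_display) (T : measurableType dT) (P : probability T R)
    (U V : {RV P >-> d.-tuple R}) :
  copula_law C (distribution P U) -> copula_law C (distribution P V) ->
  (forall A B, measurable A -> measurable B ->
     P (U @^-1` A `&` V @^-1` B) = (P (U @^-1` A) * P (V @^-1` B))%E) ->
  (1 < #|I|)%N ->
  (kappa C I)%:E =
    P ([set t | forall k, k \in I -> tnth (U t) k <= tnth (V t) k] `|`
       [set t | forall k, k \in I -> tnth (V t) k <= tnth (U t) k]).
Proof.
move=> UC VC UV I1; rewrite /kappa leqNgt I1/=.
have mUV : measurable_fun [set: T] (fun t => (U t, V t)).
  exact: measurable_fun_pair.
pose W := isMeasurableFun.Build _ _ _ _ _ mUV.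
pose UVm : {mfun T >-> (d.-tuple R * d.-tuple R)%type} :=
    HB.pack (fun t => (U t, V t)) W.
have -> : (law C \x law C)%E [set z | concordant I z.1 z.2] =
   distribution P UVm [set z | concordant I z.1 z.2].
  apply: product_measure_unique; last exact: measurable_concordant.
  move=> A B mA mB.
  have EU := copula_law_unique UC (law_copula C) mA.
  have EV := copula_law_unique VC (law_copula C) mB.
  exact: (etrans (UV _ _ mA mB) (congr2 mule EU EV)).
by rewrite fineK// fin_num_measure//; exact: measurable_concordant.
Qed.

Section extremal.
Context {R : realType} {d : nat}.

(* Indices start at 0: k stands for the k+1-st extremal copula, and digit j,
   counted from the most significant one, has weight 2 ^ (d - 1 - j). *)
Definition digit (k : 'I_(2 ^ d.-1)) (j : 'I_d) : nat :=
  ((k %/ 2 ^ (d.-1 - j)) %% 2)%N.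

Definition zero_digits (k : 'I_(2 ^ d.-1)) : {set 'I_d} :=
  [set j | digit k j == 0%N].

(* Since all u_j <= 1, starting the iterated minimum at 1 only matters for an
   empty J. *)
Definition min_over (J : {set 'I_d}) (u : d.-tuple {i01 R}) : R :=
  \big[Num.min/1]_(j in J) (tnth u j)%:num.

Definition extremal (k : 'I_(2 ^ d.-1)) (u : d.-tuple {i01 R}) : R :=
  Num.max (min_over (zero_digits k) u + min_over (~: zero_digits k) u - 1) 0.

Definition extremal_mixture (C : copula R d) :=
  exists w : 'I_(2 ^ d.-1) -> R,
    [/\ forall k, 0 <= w k,
        \sum_k w k = 1
      & forall u, C u = \sum_k w k * extremal k u].

End extremal.

(* Main.v *)
Require Import Defs.
From HB Require Import structures.
From mathcomp Require Import all_boot all_order all_algebra.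
From mathcomp Require Import all_classical all_reals all_analysis.
From mathcomp Require Import measurable_realfun ring lra.
Import Order.TTheory GRing.Theory Num.Theory.
Local Open Scope ring_scope.

Set Implicit Arguments.
Unset Strict Implicit.
Unset Printing Implicit Defensive.

(** The [k]th extremal copula is the law of [side S V], where [S] is the set of
    zero digits of [k] and [V] is uniform on [0, 1]: the coordinates in [S] equal
    [V] and the others equal [1 - V].  An extremal mixture is the law obtained by
    drawing [k] with probability [w k] first.

    Its concordance probabilities are linear in [w].  Let [(k, V)] and [(l, V')]
    be independent draws.  All coordinates of the first vector lie at distance
    [|V - 1/2|] from [1/2], and all those of the second at distance
    [|V' - 1/2|].  Almost surely one distance is strictly larger, and each vector
    is equally likely to be the farther one, whatever [k] and [l] are.  The
    farther vector alone decides concordance on [I]: it is concordant with the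
    other exactly when its coordinates in [I] lie on one side of [1/2], that is,
    when [I] is contained in the set of zero digits or in its complement
    ([concordant_farther], [concordance_sides]).  Averaging over [k] and [l]
    gives

      kappa(C_I) = sum of the [w k] over the [k] that are one-sided on [I]

    ([kappa_mixture]).

    Existence: a pair of observations [i], [j] without ties determines the set
    [below i j] of coordinates in which the first is smaller, and [below j i] is
    its complement.  So each unordered pair of observations selects exactly one
    [k], through the orientation that puts the first coordinate in the set.  The
    proportion of unordered pairs that select [k] is a system of weights with the
    same concordance sums as the sample, since a pair is concordant on [I] exactly
    when its set is one-sided on [I] ([emp_kappa_weights]).

    Uniqueness: spread [w k] over the set of zero digits of [k] and over its
    complement.  For nonempty [I] the concordance sums are then the sums of this
    function over the supersets of [I], and its total sum is 2; so they determine
    it by Moebius inversion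
    ([superset_sums_eq0], [one_sided_weights_inj]). *)

(** * Sign patterns with first digit zero *)

Lemma binary_digits_inj m (a b : nat) : (a < 2 ^ m)%N -> (b < 2 ^ m)%N ->
  (forall i, (i < m)%N -> (a %/ 2 ^ i) %% 2 = (b %/ 2 ^ i) %% 2)%N -> a = b.
Proof.
elim: m a b => [|m IHm] a b; first by rewrite expn0 !ltnS !leqn0 => /eqP-> /eqP->.
rewrite expnSr -!ltn_divLR// => am bm ab.
rewrite (divn_eq a 2) (divn_eq b 2); congr (_ * _ + _)%N.
  by apply: IHm => // i im; have := ab i.+1 im; rewrite expnS !divnMA.
by have := ab 0%N isT; rewrite expn0 !divn1.
Qed.

Section binary_patterns.
Context {d : nat}.
Implicit Types (S : {set 'I_d}) (k : 'I_(2 ^ d.-1)).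

Lemma zero_digits_first k (o : 'I_d) : val o = 0%N -> o \in zero_digits k.
Proof. by move=> o0; rewrite inE /digit o0 subn0 divn_small ?ltn_ord. Qed.

Lemma zero_digits_inj : injective (@zero_digits d).
Proof.
move=> k l kl; apply/val_inj/(@binary_digits_inj d.-1) => [||i id]; rewrite ?ltn_ord//.
have jd : (d.-1 - i < d)%N.
  by apply: (leq_ltn_trans (leq_subr _ _)); rewrite ltn_predL; case: (d) id.
have /setP/(_ (Ordinal jd)) := kl; rewrite !inE /digit/= subKn 1?ltnW//.
by rewrite !modn2; case: odd; case: odd.
Qed.

(** By cardinality: there are as many indices [k] as sets containing a given
    coordinate, so that [k] can be replaced with such a set as an index. *)
Lemma zero_digits_image (o : 'I_d) : val o = 0%N ->
  [set zero_digits k | k : 'I_(2 ^ d.-1)] = [set S : {set 'I_d} | o \in S].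
Proof.
move=> o0; apply/eqP; rewrite eqEcard; apply/andP; split.
  by apply/fintype.subsetP => _ /imsetP[k _ ->]; rewrite inE zero_digits_first.
rewrite card_imset; last exact: zero_digits_inj.
rewrite card_ord -[d in d.-1]card_ord -(cardsC1 o) -card_powerset.
have sub : [set S : {set 'I_d} | o \in S] \subset
    [set o |: S | S in powerset (~: [set o])].
  apply/fintype.subsetP => S; rewrite inE => oS; apply/imsetP; exists (S :\ o).
    by rewrite inE; apply/fintype.subsetP => x; rewrite !inE => /andP[].
  by rewrite finset.setD1K.
by apply: leq_trans (subset_leq_card sub) _; exact: leq_imset_card.
Qed.

Lemma big_zero_digits (V : nmodType) (o : 'I_d) (F : {set 'I_d} -> V) :
  val o = 0%N -> \sum_k F (zero_digits k) = \sum_(S : {set 'I_d} | o \in S) F S.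
Proof.
move=> o0; transitivity
  (\sum_(S in [set zero_digits k | k : 'I_(2 ^ d.-1)]) F S).
  by rewrite big_imset//= => k l _ _; exact: zero_digits_inj.
by apply: eq_bigl => S; rewrite (zero_digits_image o0) inE.
Qed.

End binary_patterns.

(** * Concordance sums determine the weights *)

(** Moebius inversion on the subset lattice: the superset sum at [S] involves,
    apart from [S], only sets with a smaller complement. *)
Lemma superset_sums_eq0 (V : zmodType) (T : finType) (nu : {set T} -> V) :
  (forall I : {set T}, \sum_(S : {set T} | I \subset S) nu S = 0) ->
  forall S, nu S = 0.
Proof.
move=> nu0 S; have [m] := ubnP #|~: S|; elim: m S => // m IHm S Sm.
have := nu0 S; rewrite (bigD1 S)//= big1 ?addr0// => S' /andP[SS' S'S].
rewrite ltnS in Sm; apply: IHm; apply: leq_trans Sm; apply: proper_card.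
by rewrite finset.properC finset.properEneq eq_sym S'S.
Qed.

Section signatures.
Context {R : realType} {d : nat}.
Implicit Types (S I : {set 'I_d}).

Definition one_sided I S := (I \subset S) || (I \subset ~: S).

(** The two inclusions exclude each other unless [I] is empty. *)
Lemma natr_one_sided I S : I != finset.set0 ->
  (one_sided I S)%:R = (I \subset S)%:R + (I \subset ~: S)%:R :> R.
Proof.
move=> /finset.set0Pn[i iI]; rewrite /one_sided.
have [/fintype.subsetP/(_ _ iI) iS|_] := boolP (I \subset S); last by rewrite add0r.
suff -> : (I \subset ~: S) = false by rewrite addr0.
by apply/negP => /fintype.subsetP/(_ _ iI); rewrite inE iS.
Qed.

Lemma one_sided_small I S : (#|I| <= 1)%N -> one_sided I S.
Proof.
rewrite leq_eqVlt ltnS leqn0 => /orP[/cards1P[i ->]|].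
  by rewrite /one_sided !finset.sub1set inE orbN.
by rewrite cards_eq0 => /eqP ->; rewrite /one_sided finset.sub0set.
Qed.

(** Each concordance sum is a superset sum of the function [nu] that spreads
    [w - w'] over the sets of zero digits and their complements, up to a factor 2
    for the empty set.  The coordinate [o] tells a set of zero digits from every
    complement of one, so no two weights are merged in [nu]. *)
Lemma one_sided_weights_inj (o : 'I_d) (w w' : 'I_(2 ^ d.-1) -> R) :
  val o = 0%N ->
  (forall I, \sum_k w k * (one_sided I (zero_digits k))%:R =
             \sum_k w' k * (one_sided I (zero_digits k))%:R) ->
  forall k, w k = w' k.
Proof.
move=> o0 ww' k; pose z := @zero_digits d.
pose delta k := w k - w' k.
have dI I : \sum_k delta k * (one_sided I (z k))%:R = 0.
  under eq_bigr do rewrite mulrBl.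
  by rewrite big_split/= sumrN ww' subrr.
pose nu S := \sum_k delta k * ((z k == S)%:R + (~: z k == S)%:R).
have nu0 : forall S, nu S = 0.
  apply: superset_sums_eq0 => I; rewrite /nu exchange_big/=.
  have one (A : {set 'I_d}) :
      \sum_(S : {set 'I_d} | I \subset S) (A == S)%:R = (I \subset A)%:R :> R.
    rewrite big_mkcond (bigD1 A)//= eqxx big1 ?addr0 => [|S /negbTE SA].
      by case: ifP.
    by rewrite eq_sym SA; case: ifP.
  under eq_bigr do rewrite -mulr_sumr big_split/= !one.
  have [->|In0] := eqVneq I finset.set0; last first.
    by under eq_bigr do rewrite -natr_one_sided//; exact: dI.
  (* The empty set lies on both sides, so its superset sum counts delta twice. *)
  have d0 : \sum_k delta k = 0.
    rewrite -[RHS](dI finset.set0); apply: eq_bigr => l _.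
    by rewrite one_sided_small ?cards0 ?mulr1.
  under eq_bigr do rewrite !finset.sub0set mulrDr mulr1.
  by rewrite big_split/= d0 addr0.
have := nu0 (z k); rewrite /nu (bigD1 k)//= eqxx big1 => [|l lk].
  rewrite addr0 (_ : (~: z k == z k) = false) ?addr0 ?mulr1; last first.
    by apply/negP => /eqP/setP/(_ o); rewrite inE zero_digits_first.
  by move/eqP; rewrite subr_eq0 => /eqP.
rewrite (inj_eq (@zero_digits_inj d)) (negbTE lk) add0r.
rewrite (_ : (~: z l == z k) = false) ?mulr0//.
by apply/negP => /eqP/setP/(_ o); rewrite inE !zero_digits_first.
Qed.

(** * Weights realizing the empirical signature *)

Section empirical_weights.
Context {n : nat} (x : 'I_n -> 'I_d -> R).

Definition below (i j : 'I_n) : {set 'I_d} := [set k | x i k <= x j k].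

(** For [S] containing a given coordinate and a sample without ties, this is the
    proportion of unordered pairs of observations with pattern [S]: exactly one
    orientation of a pair puts that coordinate in [below i j], and there are
    [n (n - 1) / 2] pairs. *)
Definition emp_weight S : R := 2 / (n%:R * (n%:R - 1)) *
  \sum_(i < n) \sum_(j < n | i != j) (below i j == S)%:R.

Lemma emp_weight_ge0 S : 0 <= emp_weight S.
Proof.
apply: mulr_ge0; last by do 2![apply: sumr_ge0 => ? _].
apply: divr_ge0 => //; case: n => [|m]; first by rewrite mul0r.
by rewrite mulr_ge0// -natr1 addrK.
Qed.

Lemma sum_pairs_swap (F : 'I_n -> 'I_n -> R) :
  \sum_i \sum_(j | i != j) F i j = \sum_i \sum_(j | i != j) F j i.
Proof.
rewrite (exchange_big_dep xpredT)//=; apply: eq_bigr => i _.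
by apply: eq_bigl => j; rewrite eq_sym.
Qed.

Hypothesis xinj : no_ties x.

Lemma belowC i j : i != j -> ~: below i j = below j i.
Proof.
move=> ij; apply/setP => k; rewrite !inE -ltNge lt_neqAle andb_idl// => _.
by apply: contra ij => /eqP/xinj ->.
Qed.

(** Reversing a pair of observations complements its pattern.  So a pair oriented
    with [o] in its pattern is one-sided on [I] exactly when one of its two
    orientations has [I] in its pattern. *)
Lemma sum_below_first (o : 'I_d) I : I != finset.set0 ->
  \sum_i \sum_(j | i != j) (o \in below i j)%:R * (one_sided I (below i j))%:R =
  \sum_i \sum_(j | i != j) (I \subset below i j)%:R :> R.
Proof.
move=> In0; under eq_bigr do under eq_bigr do rewrite natr_one_sided// mulrDr.
under eq_bigr do rewrite big_split/=.
rewrite big_split/= [X in _ + X]sum_pairs_swap -big_split/=.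
apply: eq_bigr => i _; rewrite -big_split/=; apply: eq_bigr => j ij.
rewrite belowC 1?eq_sym// -mulrDl -(belowC ij) finset.in_setC.
by case: (o \in _); rewrite /= ?addr0 ?add0r mul1r.
Qed.

Lemma sum_below_half (o : 'I_d) :
  \sum_i \sum_(j | i != j) (o \in below i j)%:R *+ 2 = n%:R * (n%:R - 1) :> R.
Proof.
under eq_bigr do under eq_bigr do rewrite mulr2n.
under eq_bigr do rewrite big_split/=.
rewrite big_split/= [X in _ + X]sum_pairs_swap -big_split/=.
transitivity (\sum_(i < n) (n%:R - 1 : R)); last first.
  by rewrite sumr_const card_ord mulr_natl.
apply: eq_bigr => i _; rewrite -big_split/=.
rewrite (eq_bigr (fun=> 1)) => [|j ij]; last first.
  by rewrite -(belowC ij) finset.in_setC; case: (o \in _); rewrite ?addr0 ?add0r.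
rewrite sumr_const (eq_card (B := predC1 i)) => [|j]; last first.
  by rewrite !inE eq_sym.
have := cardC1 i; rewrite card_ord => ->.
by case: (n) i => [[]//|m _]; rewrite /= -natr1 addrK.
Qed.

Lemma emp_weight_one_sided (o : 'I_d) I : I != finset.set0 ->
  \sum_(S : {set 'I_d} | o \in S) emp_weight S * (one_sided I S)%:R =
  2 / (n%:R * (n%:R - 1)) *
    \sum_(i < n) \sum_(j < n | i != j) (I \subset below i j)%:R.
Proof.
move=> In0; rewrite -(sum_below_first o)//.
under eq_bigr do rewrite /emp_weight -[2 / _ * _ * _]mulrA.
rewrite -mulr_sumr; congr (_ * _).
under eq_bigr do rewrite mulr_suml.
rewrite exchange_big/=; apply: eq_bigr => i _.
under eq_bigr do rewrite mulr_suml.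
rewrite exchange_big/=; apply: eq_bigr => j _.
rewrite big_mkcond (bigD1 (below i j))//= eqxx big1 ?addr0 => [|S /negbTE SA].
  by case: ifP; rewrite ?mul1r ?mul0r.
by rewrite eq_sym SA mul0r; case: ifP.
Qed.

(** Every pattern is one-sided on a singleton, which turns the total weight into
    the count of oriented pairs of [sum_below_half]. *)
Lemma emp_weight_sum (o : 'I_d) : (2 <= n)%N ->
  \sum_(S : {set 'I_d} | o \in S) emp_weight S = 1.
Proof.
move=> n2.
transitivity (\sum_(S : {set 'I_d} | o \in S) emp_weight S * (one_sided [set o] S)%:R).
  by apply: eq_bigr => S _; rewrite one_sided_small ?cards1 ?mulr1.
rewrite emp_weight_one_sided; last by apply/finset.set0Pn; exists o; rewrite inE.
have N0 : n%:R * (n%:R - 1) != 0 :> R.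
  rewrite mulf_neq0 ?pnatr_eq0 -?lt0n ?(ltn_trans _ n2)//.
  by rewrite subr_eq0 (eqr_nat R n 1) gtn_eqF.
under eq_bigr do under eq_bigr do rewrite finset.sub1set.
apply: (mulfI N0); rewrite mulr1 mulrA mulrCA divff// mulr1.
rewrite -[RHS](sum_below_half o) mulr_sumr; apply: eq_bigr => i _.
by rewrite mulr_sumr; apply: eq_bigr => j _; rewrite mulr_natl.
Qed.

Lemma emp_kappa_weights (o : 'I_d) I : (2 <= n)%N ->
  emp_kappa x I = \sum_(S : {set 'I_d} | o \in S) emp_weight S * (one_sided I S)%:R.
Proof.
move=> n2; rewrite /emp_kappa; case: ifPn => [I1|].
  under eq_bigr do rewrite one_sided_small// mulr1.
  by rewrite emp_weight_sum.
rewrite -ltnNge => I1; rewrite emp_weight_one_sided; last first.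
  by rewrite -card_gt0 (ltn_trans _ I1).
congr (_ * _); apply: eq_bigr => i _; apply: eq_bigr => j _.
have [/fintype.subsetP Ib|] := boolP (I \subset _).
  by rewrite big1// => k /Ib; rewrite inE => ->.
move=> /fintype.subsetPn[k kI]; rewrite inE => /negbTE xk.
by rewrite (bigD1 k)//= xk mul0r.
Qed.

End empirical_weights.
End signatures.

(** * The uniform law on the unit interval *)

Section uniform.
Local Open Scope classical_set_scope.
Context {R : realType}.

(** [uniform_prob] lives on [measurableTypeR R], whose measurable structure has
    another display than that of [R] as a component of tuples.  This copy lives on
    the latter, so that images and products of it combine with laws of tuples. *)
Definition unif01_fun : set R -> \bar R := uniform_prob (@ltr01 R).

HB.instance Definition _ := isMeasure.Build _ R R unif01_fun
  (measure0 (uniform_prob (@ltr01 R))) (measure_ge0 (uniform_prob (@ltr01 R)))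
  (measure_semi_sigma_additive (s := uniform_prob (@ltr01 R))).

HB.instance Definition _ := Measure_isProbability.Build _ _ _ unif01_fun
  (probability_setT (uniform_prob (@ltr01 R))).

Definition unif01 : probability R R := unif01_fun.

Local Notation U := unif01.
Local Notation mu := (@lebesgue_measure R).

Lemma uniform01E (A : set R) : measurable A -> U A = mu (A `&` `[0, 1]).
Proof.
move=> mA; rewrite -[U _]/(uniform_prob (@ltr01 R) _) /uniform_prob.
rewrite integral_uniform_pdf.
have mA1 : measurable (A `&` `[0, 1]) by exact: measurableI.
rewrite (eq_integral (cst 1%E)) ?integral_cst ?mul1e// => x.
by rewrite inE => -[_]; rewrite /= in_itv/= /uniform_pdf => ->; rewrite subr0 invr1.
Qed.

Lemma measurable_reflection : measurable_fun [set: R] (fun v : R => 1 - v).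
Proof. exact: measurable_funB. Qed.

Lemma lebesgue_reflection (A : set R) : measurable A ->
  mu ((fun v => 1 - v) @^-1` A) = mu A.
Proof.
move=> mA; apply/esym; pose rho (v : R) : measurableTypeR R := 1 - v.
rewrite -[RHS]/(pushforward mu rho A).
apply: lebesgue_measure_unique => //=; first exact: measurable_reflection.
move=> _ _ [[a b] _ <-].
rewrite /pushforward /rho (_ : _ @^-1` _ = `[1 - b, 1 - a[%classic); last first.
  apply/seteqP; split=> v; rewrite /= !in_itv/= => /andP[? ?]; apply/andP; split; lra.
rewrite /= !lebesgue_measure_itv/= !lte_fin ltrD2l ltrN2; case: ifP => // _.
by congr (_%:E); ring.
Qed.

Lemma uniform_reflection (A : set R) : measurable A ->
  U ((fun v => 1 - v) @^-1` A) = U A.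
Proof.
move=> mA; have mA' : measurable ((fun v : R => 1 - v) @^-1` A).
  by rewrite -[X in measurable X]setTI; exact: measurable_reflection.
rewrite !uniform01E// -[RHS]lebesgue_reflection; last exact: measurableI.
congr (mu _); rewrite preimage_setI; congr (_ `&` _).
by apply/seteqP; split=> v; rewrite /= !in_itv/= => /andP[? ?]; apply/andP; split; lra.
Qed.

Lemma between_itvE (a b : R) :
  [set v | v <= a] `&` [set v | 1 - v <= b] = `[1 - b, a]%classic.
Proof.
apply/seteqP; split=> v; rewrite /= in_itv/=.
  by move=> [? ?]; apply/andP; split; lra.
by move=> /andP[? ?]; split; lra.
Qed.

Lemma uniform_between (a b : R) : 0 <= a <= 1 -> 0 <= b <= 1 ->
  U ([set v | v <= a] `&` [set v | 1 - v <= b]) = (Num.max (a + b - 1) 0)%:E.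
Proof.
move=> a01 b01; rewrite between_itvE.
rewrite uniform01E// setIidl; last first.
  by move=> v; rewrite /= !in_itv/= => /andP[? ?]; apply/andP; split; lra.
rewrite lebesgue_measure_itv/= lte_fin; case: ifPn => h.
  by congr (_%:E); rewrite max_l; [ring|lra].
by rewrite max_r//; lra.
Qed.

Lemma uniform_atom (a : R) : U [set a] = 0%E.
Proof.
rewrite uniform01E//; apply: (@subset_measure0 _ _ _ mu _ [set a]) => //.
- exact: measurableI.
- exact: lebesgue_measure_set1.
Qed.

End uniform.

(** * Which of two independent uniform points is farther from 1/2 *)

Section distance_to_the_middle.
Local Open Scope classical_set_scope.
Context {R : realType}.
Local Notation U := (@unif01 R).
Local Notation U2 := (U \x U)%E.

Definition mid_dist (v : R) : R := `|v - 2^-1|.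

Lemma measurable_mid_dist : measurable_fun [set: R] mid_dist.
Proof. by apply: measurableT_comp => //; exact: measurable_funB. Qed.

Definition farther : set (R * R) := [set z | mid_dist z.2 < mid_dist z.1].

Lemma measurable_swap_pair : measurable_fun [set: R * R] (@swap_pair R R).
Proof. exact: measurable_fun_pair. Qed.

Lemma measurable_farther : measurable farther.
Proof.
rewrite (_ : farther = ~` [set z | mid_dist z.1 <= mid_dist z.2]); last first.
  by apply/seteqP; split=> z; rewrite /farther/= ltNge => /negP.
apply: measurableC; rewrite -[X in measurable X]setTI.
apply: measurable_fun_le => //.
- exact: (measurableT_comp measurable_mid_dist measurable_fst).
- exact: (measurableT_comp measurable_mid_dist measurable_snd).
Qed.

Lemma measurable_swap_farther : measurable (swap_pair @^-1` farther).
Proof.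
rewrite -[X in measurable X]setTI.
by apply: measurable_swap_pair => //; exact: measurable_farther.
Qed.

Lemma uniform_swap (A : set (R * R)) : measurable A -> U2 (swap_pair @^-1` A) = U2 A.
Proof.
move=> mA; pose M := isMeasurableFun.Build _ _ _ _ _ measurable_swap_pair.
pose f : {mfun (R * R)%type >-> (R * R)%type} := HB.pack (@swap_pair R R) M.
apply/esym; rewrite -[RHS]/(distribution U2 f A).
apply: product_measure_unique => // B C mB mC.
rewrite /= /distribution /pushforward (_ : _ @^-1` _ = C `*` B); last first.
  by apply/seteqP; split=> z [].
by rewrite product_measure1E// muleC.
Qed.

(** A point [x] is tied only with [x] and [1 - x], so every section of the set of
    ties is null. *)
Lemma mid_dist_ties_null (A : set (R * R)) : measurable A ->
  A `&` farther = set0 -> A `&` swap_pair @^-1` farther = set0 -> U2 A = 0%E.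
Proof.
move=> mA A1 A2; rewrite /product_measure1; apply: integral0_eq => x _ /=.
apply: (@subset_measure0 _ _ _ U _ ([set x] `|` [set 1 - x])) => //.
- exact: measurable_xsection.
- exact: measurableU.
- move=> y; rewrite /xsection/= inE => Axy.
  have n1 : ~ farther (x, y) by move=> h; rewrite -[False]/(set0 (x, y)) -A1.
  have n2 : ~ farther (y, x) by move=> h; rewrite -[False]/(set0 (x, y)) -A2.
  move/negP: n1; move/negP: n2; rewrite /= -!leNgt => h1 h2.
  have : mid_dist x == mid_dist y by rewrite eq_le h1 h2.
  by rewrite /mid_dist eqr_norm2 => /orP[] /eqP ?; [left|right]; rewrite /=; lra.
- apply: etrans (measureU0 _ _ _) _ => //; exact: uniform_atom.
Qed.

Lemma split_by_mid_dist (A : set (R * R)) : measurable A ->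
  U2 A = (U2 (A `&` farther) + U2 (A `&` swap_pair @^-1` farther))%E.
Proof.
move=> mA; have mD := measurable_farther; have mD' := measurable_swap_farther.
rewrite -measureU//; last first.
- rewrite setIACA setIid (_ : farther `&` _ = set0) ?setI0//.
  by apply/seteqP; split=> // z [] /= /lt_trans h /h; rewrite ltxx.
- exact: measurableI.
- exact: measurableI.
rewrite -setIUr -[in LHS](setIT A).
rewrite -(setUv (farther `|` swap_pair @^-1` farther)) setIUr measureU0//.
- by apply: measurableI => //; exact: measurableU.
- by apply: measurableI => //; apply: measurableC; exact: measurableU.
apply: mid_dist_ties_null.
- by apply: measurableI => //; apply: measurableC; exact: measurableU.
- by apply/seteqP; split=> // z [[_ nz] Dz]; apply: nz; left.
- by apply/seteqP; split=> // z [[_ nz] Dz]; apply: nz; right.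
Qed.

(** By exchangeability of the two points, since ties are null. *)
Lemma uniform_farther : U2 farther = (2^-1)%:E.
Proof.
have := split_by_mid_dist measurableT.
rewrite !setTI uniform_swap; last exact: measurable_farther.
rewrite probability_setT.
have /fineK <- : U2 farther \is a fin_num.
  exact: (fin_num_measure (U2 : probability (R * R)%type R) _ measurable_farther).
by rewrite -EFinD => -[h]; congr _%:E; lra.
Qed.

End distance_to_the_middle.

(** * Laws of the extremal copulas and their concordance *)

Section sides.
Local Open Scope classical_set_scope.
Context {R : realType} {d : nat}.
Implicit Types (S T I : {set 'I_d}).
Local Notation U := (@unif01 R).
Local Notation U2 := (U \x U)%E.

Definition side S (v : R) : d.-tuple R :=
  [tuple if j \in S then v else 1 - v | j < d].

Lemma measurable_side S : measurable_fun [set: R] (side S).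
Proof.
apply/measurable_fun_tnthP => j.
rewrite (_ : _ \o _ = if j \in S then id else fun v => 1 - v); last first.
  by apply/funext => v; rewrite /= tnth_mktuple; case: ifP.
by case: ifP => _ //; exact: measurable_reflection.
Qed.

HB.instance Definition _ S :=
  isMeasurableFun.Build _ _ _ _ (side S) (measurable_side S).

Lemma side_margin S j (A : set R) : measurable A ->
  distribution U (side S) ((fun x => tnth x j) @^-1` A) = U A.
Proof.
move=> mA; rewrite /distribution /pushforward.
have [jS|jS] := boolP (j \in S).
  by congr (U _); apply/seteqP; split=> v; rewrite /= tnth_mktuple jS.
rewrite -[RHS]uniform_reflection//; congr (U _).
by apply/seteqP; split=> v; rewrite /= tnth_mktuple (negbTE jS).
Qed.

(** The bound on [v] accounts for the initial value 1 of the minimum. *)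
Lemma min_over_le S (u : d.-tuple {i01 R}) (v : R) : v <= 1 ->
  (v <= min_over S u) = [forall j in S, v <= (tnth u j)%:num].
Proof.
move=> v1; apply/bigmin_geP/forall_inP => [[_ h] j jS|h]; first exact: h.
by split.
Qed.

Lemma min_over01 S (u : d.-tuple {i01 R}) : 0 <= min_over S u <= 1.
Proof.
apply/andP; split; first by apply/bigmin_geP; split=> //.
exact: bigmin_le_id.
Qed.

Lemma side_orthant S (u : d.-tuple {i01 R}) :
  distribution U (side S) (orthant (fun j => (tnth u j)%:num)) =
  (Num.max (min_over S u + min_over (~: S) u - 1) 0)%:E.
Proof.
rewrite -uniform_between ?min_over01//.
have mo : measurable (side S @^-1` orthant (fun j => (tnth u j)%:num)).
  rewrite -[X in measurable X]setTI; apply: measurable_side => //.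
  exact: measurable_orthant.
rewrite /distribution /pushforward !uniform01E//; last first.
  by rewrite between_itvE.
congr (lebesgue_measure _); apply/seteqP; split=> v /= [h];
  rewrite in_itv/= => v01; split=> //; case/andP: (v01) => v0 v1.
  split; rewrite min_over_le ?lerBlDr ?lerDl//; apply/forall_inP => j jS.
    by have := h j; rewrite tnth_mktuple jS.
  by have := h j; rewrite tnth_mktuple; move: jS; rewrite inE => /negbTE ->.
have [] := h; rewrite !min_over_le ?lerBlDr ?lerDl// => /forall_inP h1 /forall_inP h2 j.
by rewrite tnth_mktuple; case: ifPn => jS; [exact: h1|apply: h2; rewrite inE].
Qed.

Lemma concordantC I (x y : d.-tuple R) : concordant I x y <-> concordant I y x.
Proof. by split=> -[]; [right|left|right|left]. Qed.

(** The coordinates of [side T b] are all closer to 1/2 than [a] and [1 - a].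
    Hence a coordinate of [side S a] exceeds its counterpart exactly when it is on
    the upper side of 1/2, whatever [T] is. *)
Lemma concordant_farther I S T (a b : R) : farther (a, b) ->
  concordant I (side S a) (side T b) <-> one_sided I S.
Proof.
rewrite /farther /= => ab.
have tT j : `|tnth (side T b) j - 2^-1| < mid_dist a.
  rewrite tnth_mktuple; case: ifP => // _.
  by rewrite (_ : 1 - b - 2^-1 = - (b - 2^-1)) ?normrN//; lra.
have tS j : tnth (side S a) j = if j \in S then a else 1 - a by rewrite tnth_mktuple.
split; last first.
  (* For a <= 1/2 the coordinates in S are the low ones, otherwise the high ones. *)
  have [ha|ha] := lerP a (2^-1); rewrite /concordant.
    have da : mid_dist a = 2^-1 - a by rewrite /mid_dist ler0_norm; lra.
    move=> /orP[] /fintype.subsetP IS; [left|right] => j jI;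
      have := tT j; have := IS _ jI; rewrite ?inE => jS;
    rewrite tS ?jS ?(negbTE jS) da ltr_norml => /andP[? ?]; lra.
  have da : mid_dist a = a - 2^-1 by rewrite /mid_dist ger0_norm; lra.
  move=> /orP[] /fintype.subsetP IS; [right|left] => j jI;
    have := tT j; have := IS _ jI; rewrite ?inE => jS;
    rewrite tS ?jS ?(negbTE jS) da ltr_norml => /andP[? ?]; lra.
(* Coordinates i and j on opposite sides are ordered oppositely. *)
move=> conc; apply/negPn/negP; rewrite negb_or => /andP[].
move=> /fintype.subsetPn[i iI iS] /fintype.subsetPn[j jI]; rewrite inE negbK => jS.
have := tT i; have := tT j; have := tS i; have := tS j; rewrite jS (negbTE iS) => Sj Si.
have [ha|ha] := lerP a (2^-1).
  have -> : mid_dist a = 2^-1 - a by rewrite /mid_dist ler0_norm; lra.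
  rewrite !ltr_norml => /andP[? ?] /andP[? ?].
  by case: conc => h; have := h i iI; have := h j jI; rewrite Si Sj; lra.
have -> : mid_dist a = a - 2^-1 by rewrite /mid_dist ger0_norm; lra.
rewrite !ltr_norml => /andP[? ?] /andP[? ?].
by case: conc => h; have := h i iI; have := h j jI; rewrite Si Sj; lra.
Qed.

Definition side_pair S T (z : R * R) := (side S z.1, side T z.2).

Lemma measurable_side_pair S T : measurable_fun [set: R * R] (side_pair S T).
Proof.
apply: measurable_fun_pair.
- exact: (measurableT_comp (measurable_side S) measurable_fst).
- exact: (measurableT_comp (measurable_side T) measurable_snd).
Qed.

HB.instance Definition _ S T :=
  isMeasurableFun.Build _ _ _ _ (side_pair S T) (measurable_side_pair S T).

Lemma concordance_sides I S T :
  distribution U2 (side_pair S T) [set z | concordant I z.1 z.2] =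
  (((one_sided I S)%:R + (one_sided I T)%:R) / 2)%:E.
Proof.
pose C := side_pair S T @^-1` [set z | concordant I z.1 z.2].
have mC : measurable C.
  rewrite -[X in measurable X]setTI; apply: measurable_side_pair => //.
  exact: measurable_concordant.
rewrite -[LHS]/(U2 C) (split_by_mid_dist mC).
have H (b : bool) (A B : set (R * R)) : measurable B -> U2 B = (2^-1)%:E ->
    (forall z, B z -> A z <-> b) -> U2 (A `&` B) = (b%:R / 2)%:E.
  move=> mB UB AB; case: b AB => AB; rewrite ?mul1r ?mul0r.
    by rewrite setIidr// => z /AB/iffRL/(_ isT).
  rewrite (_ : _ `&` _ = set0) ?measure0//.
  by apply/seteqP; split=> // z [Az /AB/iffLR/(_ Az)].
rewrite (H (one_sided I S))//=; first rewrite (H (one_sided I T))//=.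
- by rewrite -EFinD mulrDl.
- exact: measurable_swap_farther.
- by rewrite uniform_swap ?uniform_farther//; exact: measurable_farther.
- by move=> [a b] ab; apply: iff_trans (concordantC _ _ _) _; exact: concordant_farther.
- exact: measurable_farther.
- exact: uniform_farther.
- by move=> [a b]; exact: concordant_farther.
Qed.

End sides.

(** * Finite mixtures of laws and their product *)

Section finite_sum_of_measures.
Local Open Scope classical_set_scope.
Local Open Scope ereal_scope.
Context d (T : measurableType d) (R : realType) (I : finType).
Variable m : I -> {measure set T -> \bar R}.

Definition fsum_measure (A : set T) : \bar R := \sum_(i : I) m i A.

Let fsum_measure0 : fsum_measure set0 = 0.
Proof. by rewrite /fsum_measure big1. Qed.

Let fsum_measure_ge0 B : 0 <= fsum_measure B.
Proof. by apply: sume_ge0. Qed.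

Let fsum_measure_sigma_additive : semi_sigma_additive fsum_measure.
Proof.
move=> F mF tF mUF; rewrite [X in _ --> X](_ : _ =
    limn (fun n => \sum_(0 <= i < n) fsum_measure (F i))).
  by apply: is_cvg_ereal_nneg_natsum => k _; exact: sume_ge0.
rewrite nneseries_sum//; apply: eq_bigr => /= i _.
exact: measure_semi_bigcup.
Qed.

HB.instance Definition _ := isMeasure.Build _ _ _ fsum_measure
  fsum_measure0 fsum_measure_ge0 fsum_measure_sigma_additive.

End finite_sum_of_measures.

Section mixtures.
Local Open Scope classical_set_scope.
Context {dT dT' : measure_display} {T : measurableType dT}
  {T' : measurableType dT'} {R : realType} {I : finType}.
Variables (P : probability T R) (X : I -> {mfun T >-> T'}) (w : I -> R).
Hypotheses (w0 : forall i, 0 <= w i) (w1 : \sum_i w i = 1).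

Definition mixture : set T' -> \bar R :=
  fsum_measure (fun i => mscale (NngNum (w0 i)) (distribution P (X i))).

HB.instance Definition _ := Measure.on mixture.

Lemma mixtureE A : mixture A = (\sum_i (w i)%:E * distribution P (X i) A)%E.
Proof. by []. Qed.

Lemma mixtureT : mixture setT = 1%E.
Proof.
rewrite mixtureE; under eq_bigr do rewrite probability_setT mule1.
by rewrite sumEFin w1.
Qed.

Lemma mixture_probability : exists Q : probability T' R,
  forall A, Q A = (\sum_i (w i)%:E * distribution P (X i) A)%E.
Proof.
pose M := Measure_isProbability.Build _ _ _ mixture mixtureT.
pose Q : probability T' R := HB.pack mixture M.
by exists Q.
Qed.

End mixtures.

Section product_of_mixtures.
Local Open Scope classical_set_scope.
Context {dT dT' : measure_display} {T : measurableType dT}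
  {T' : measurableType dT'} {R : realType} {I : finType}.
Variables (P : probability T R) (X : I -> {mfun T >-> T'}) (w : I -> R).
Hypotheses (w0 : forall i, 0 <= w i).
Variable Q : probability T' R.
Hypothesis QE : forall A, measurable A ->
  Q A = (\sum_i (w i)%:E * distribution P (X i) A)%E.
Variable XX : I * I -> {mfun (T * T)%type >-> (T' * T')%type}.
Hypothesis XXE : forall p z, XX p z = (X p.1 z.1, X p.2 z.2).

(** Both sides are measures and agree on rectangles by distributivity.  The right
    one is itself a mixture, indexed by pairs, which makes it a measure. *)
Lemma product_mixtureE A : measurable A ->
  (Q \x Q)%E A =
  (\sum_p (w p.1 * w p.2)%:E * distribution (P \x P)%E (XX p) A)%E.
Proof.
move=> mA.
have ww0 p : 0 <= w p.1 * w p.2 by exact: mulr_ge0.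
rewrite -[RHS]/(mixture (P \x P)%E XX ww0 A).
apply: product_measure_unique => // B C mB mC.
transitivity (Q B * Q C)%E => //; rewrite !QE//; apply: etrans (mixtureE _ _ _ _) _.
have fX D i : measurable D ->
    distribution P (X i) D = (fine (distribution P (X i) D))%:E.
  by move=> mD; rewrite fineK// fin_num_measure.
under [in RHS]eq_bigr do rewrite fX// -EFinM.
under [X in (_ * X)%E]eq_bigr do rewrite fX// -EFinM.
rewrite !sumEFin -EFinM big_distrlr/= pair_big/= -sumEFin; apply: eq_bigr => p _.
rewrite [in RHS]mulrACA [in RHS]EFinM; congr (_ * _)%E.
rewrite EFinM -!fX// /distribution /pushforward.
rewrite -product_measure1E//.
- by congr ((P \x P)%E _); apply/seteqP; split=> z; rewrite /= XXE.
- by rewrite -[X in measurable X]setTI; exact: measurable_funPT.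
- by rewrite -[X in measurable X]setTI; exact: measurable_funPT.
Qed.

End product_of_mixtures.

(** * Extremal mixture copulas *)

Section extremal_mixtures.
Local Open Scope classical_set_scope.
Context {R : realType} {d : nat}.
Implicit Types (w : 'I_(2 ^ d.-1) -> R) (I : {set 'I_d}) (C : copula R d).
Local Notation zd := (@zero_digits d).

Lemma copula_ext (C1 C2 : copula R d) : C1 =1 C2 -> C1 = C2.
Proof.
case: C1 C2 => [f Pf] [g Pg] /= /funext fg; case: _ / fg Pg => Pg.
by congr Copula; exact: Prop_irrelevance.
Qed.

Definition side_mixture w (Q : probability (d.-tuple R) R) := forall A, measurable A ->
  Q A = (\sum_k (w k)%:E * distribution unif01 (side (zd k)) A)%E.

Lemma side_mixture_copula_law w Q : \sum_k w k = 1 -> side_mixture w Q ->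
  copula_law (fun u => \sum_k w k * extremal k u) Q.
Proof.
move=> w1 QE; split=> [j A mA|u].
  rewrite QE; last exact: measurable_tnth_preimage.
  under eq_bigr do rewrite side_margin//.
  have UA : unif01 A \is a fin_num by rewrite fin_num_measure.
  rewrite -[RHS]/(unif01 A) -(fineK UA).
  under eq_bigr do rewrite -EFinM.
  by rewrite sumEFin -mulr_suml w1 mul1r.
rewrite QE; last exact: measurable_orthant.
by under eq_bigr do rewrite side_orthant -EFinM; rewrite sumEFin.
Qed.

(** The law attached to a copula is a chosen one; uniqueness of the law identifies
    it with the explicit mixture. *)
Lemma side_mixture_law w C : (forall k, 0 <= w k) -> \sum_k w k = 1 ->
  (forall u, C u = \sum_k w k * extremal k u) -> side_mixture w (law C).
Proof.
move=> w0 w1 CE A mA.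
have [Q QE] := mixture_probability unif01 (fun k => side (zd k)) w0 w1.
rewrite -QE; apply: (copula_law_unique (law_copula C)) => //.
have -> : copula_df C = fun u => \sum_k w k * extremal k u by exact/funext.
by apply: side_mixture_copula_law => // B mB; exact: QE.
Qed.

(** The double sum of [w k * w l * (o k + o l) / 2] collapses because each
    marginal sum of the weights is 1. *)
Lemma kappa_mixture w C I : (forall k, 0 <= w k) -> \sum_k w k = 1 ->
  (forall u, C u = \sum_k w k * extremal k u) ->
  kappa C I = \sum_k w k * (one_sided I (zd k))%:R.
Proof.
move=> w0 w1 CE; rewrite /kappa; case: ifPn => [I1|_].
  by under eq_bigr do rewrite one_sided_small// mulr1.
rewrite (product_mixtureE w0 (side_mixture_law w0 w1 CE)
  (XX := fun p => side_pair (zd p.1) (zd p.2)))//; last first.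
  exact: measurable_concordant.
under eq_bigr do rewrite concordance_sides -EFinM.
rewrite sumEFin/=; pose o k : R := (one_sided I (zd k))%:R.
transitivity (\sum_k \sum_l w k * w l * ((o k + o l) / 2)).
  by rewrite pair_big.
transitivity (\sum_k (w k * o k / 2 + w k / 2 * \sum_l w l * o l)).
  apply: eq_bigr => k _; rewrite -[w k * o k / 2]mulr1 -w1 !mulr_sumr -big_split/=.
  by apply: eq_bigr => l _; ring.
rewrite big_split/= -!mulr_suml w1; lra.
Qed.

End extremal_mixtures.

Theorem theorem2 (R : realType) (d n : nat) (dT : measure_display)
    (Omega : measurableType dT) (P : probability Omega R)
    (X : 'I_n -> 'I_d -> {RV P >-> R}) :
  (2 <= d)%N -> (2 <= n)%N ->
  random_sample X -> continuous_margins X ->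
  forall w : Omega, no_ties (fun i k => X i k w) ->
  exists! C : copula R d,
    extremal_mixture C /\ emp_signature (fun i k => X i k w) = signature C.
Proof.
move=> d2 n2 _ _ omega; set x := fun i k => X i k omega => xinj.
have d0 : (0 < d)%N by exact: ltnW.
pose o : 'I_d := Ordinal d0.
pose w (k : 'I_(2 ^ d.-1)) := emp_weight x (zero_digits k).
have w0 k : 0 <= w k by exact: emp_weight_ge0.
have w1 : \sum_k w k = 1.
  by rewrite (big_zero_digits (o := o) (emp_weight x))// emp_weight_sum.
have [Q QE] := mixture_probability unif01 (fun k => side (zero_digits k)) w0 w1.
have QL : copula_law (fun u => \sum_k w k * extremal k u) Q.
  by apply: side_mixture_copula_law => // A _; exact: QE.
have sig (C : copula R d) v : (forall k, 0 <= v k) -> \sum_k v k = 1 ->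
    (forall u, C u = \sum_k v k * extremal k u) ->
    emp_signature x = signature C <->
    forall I, \sum_k w k * (one_sided I (zero_digits k))%:R =
              \sum_k v k * (one_sided I (zero_digits k))%:R.
  move=> v0 v1 CE; have eI I : emp_kappa x I =
      \sum_k w k * (one_sided I (zero_digits k))%:R.
    rewrite (emp_kappa_weights xinj o)//; apply/esym.
    exact: (big_zero_digits (o := o) (fun S => emp_weight x S * (one_sided I S)%:R)).
  split=> [/ffunP sC I|h].
    by have := sC I; rewrite !ffunE (kappa_mixture _ v0 v1 CE) eI.
  by apply/ffunP => I; rewrite !ffunE eI (kappa_mixture _ v0 v1 CE).
pose C := Copula (ex_intro _ Q QL).
have CE u : C u = \sum_k w k * extremal k u by [].
exists C; split; first by split; [exists w|apply/(sig C w w0 w1 CE)].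
move=> C' [[v [v0 v1 vE]] /(sig C' v v0 v1 vE) /(one_sided_weights_inj (o := o)) wv].
by apply: copula_ext => u; rewrite CE vE; apply: eq_bigr => k _; rewrite wv.
Qed.
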